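(* Let $k$ be a field of characteristic not two or three, let $(V,\omega_V)$ and $(W,\omega_W)$ be two-dimensional symplectic vector spaces over $k$ and let $\alpha,\beta\in k^*$. The orthogonal representation $$\mathfrak{sp}(V,\omega_V)\times \mathfrak{sp}(W,\omega_W)\rightarrow \mathfrak{so}(V\otimes W, \omega_V\otimes \omega_W)$$ of the quadratic Lie algebra $\left(\mathfrak{sp}(V,\omega_V)\times \mathfrak{sp}(W,\omega_W),\ \tfrac{1}{\alpha}K_V\perp \tfrac{1}{\beta}K_W\right)$ is a special orthogonal representation if and only if $\alpha+\beta=-1$.
   Context: A quadratic Lie algebra is a Lie algebra with a non-degenerate ad-invariant symmetric bilinear form. For an orthogonal representation $\rho:\mathfrak{g}\to\mathfrak{so}(E,(\ ,\ ))$ of a finite-dimensional quadratic Lie algebra $(\mathfrak{g},B_{\mathfrak{g}})$ on a finite-dimensional quadratic vector space $(E,(\ ,\ ))$, the moment map is the alternating bilinear map $\mu:E\times E\to\mathfrak{g}$ determined by $B_{\mathfrak{g}}(x,\mu(v,w))=(\rho(x)(v),w)$ for all $x\in\mathfrak{g}$, $v,w\in E$. Write $\mu(u,v)(w)$ for $\rho(\mu(u,v))(w)$. The representation is called special orthogonal if $$\mu(u,v)(w)+\mu(u,w)(v)=(u,v)w+(u,w)v-2(v,w)u\qquad\forall u,v,w\in E.$$ The symmetric bilinear form $\omega_V\otimes\omega_W$ on $V\otimes W$ is defined (note the sign) by $$\omega_V\otimes \omega_W(v_1\otimes w_1,v_2\otimes w_2)=-\omega_V(v_1,v_2)\,\omega_W(w_1,w_2).$$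 The form $K_V$ on $\mathfrak{sp}(V,\omega_V)$ is $K_V(f,g)=\frac12 \mathrm{Tr}(fg)$, and $K_W$ on $\mathfrak{sp}(W,\omega_W)$ is $K_W(f,g)=\frac12\mathrm{Tr}(fg)$. The representation is the tensor product action $(f,g)\cdot(v\otimes w)=f(v)\otimes w+v\otimes g(w)$. *)

(* Defs.v *)
From HB Require Import structures.
From mathcomp Require Import all_boot all_order all_algebra.

Set Implicit Arguments.
Unset Strict Implicit.
Unset Printing Implicit Defensive.

Import GRing.Theory.
Local Open Scope ring_scope.

HB.mixin Record Vector_isLie (k : fieldType) L of Vector k L := {
  lie : L -> L -> L;
  lie_linearl : forall y, linear (lie ^~ y);
  lie_linearr : forall x, linear (lie x);
  lie_alternating : forall x, lie x x = 0;
  lie_jacobi : forall x y z,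
    lie x (lie y z) + lie y (lie z x) + lie z (lie x y) = 0
}.

#[short(type="lieType")]
HB.structure Definition Lie (k : fieldType) :=
  { L of Vector_isLie k L & Vector k L }.

Section LieProd.
Variables (k : fieldType) (g h : lieType k).

Definition prod_lie (x y : (g * h)%type) : (g * h)%type :=
  (lie x.1 y.1, lie x.2 y.2).

Fact prod_lie_linearl y : linear (prod_lie ^~ y).
Proof. by move=> a u v; congr pair; apply: lie_linearl. Qed.

Fact prod_lie_linearr x : linear (prod_lie x).
Proof. by move=> a u v; congr pair; apply: lie_linearr. Qed.

Fact prod_lie_alternating x : prod_lie x x = 0.
Proof. by congr pair; apply: lie_alternating. Qed.

Fact prod_lie_jacobi x y z :
  prod_lie x (prod_lie y z) + prod_lie y (prod_lie z x)
    + prod_lie z (prod_lie x y) = 0.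
Proof. by congr pair; apply: lie_jacobi. Qed.

HB.instance Definition _ := Vector_isLie.Build k (g * h)%type
  prod_lie_linearl prod_lie_linearr prod_lie_alternating prod_lie_jacobi.

End LieProd.

Section Forms.
Variables (k : fieldType) (E : vectType k) (eps : bool).
Variable (B : {hermitian E for eps & idfun}).

Let e := vbasis {:E}.

Lemma vbasis_expand (x : E) : x = \sum_i coord e i x *: e`_i.
Proof. by apply: coord_vbasis; apply: memvf. Qed.

Lemma nondegenerateP :
  reflect (forall x, (forall y, B x y = 0) -> x = 0) (nondegenerate B).
Proof.
rewrite /nondegenerate; apply: (iffP eqP) => [B0 x Bx|B0].
  apply/eqP; rewrite -memv0 -B0; apply/mem_orthovP => y _; exact: Bx.
apply/vspaceP => x; rewrite memv0; apply/mem_orthovP/eqP => [Bx|->].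
  by apply: B0 => y; apply: Bx; apply: memvf.
by move=> y _; rewrite linear0l.
Qed.

Definition skew_defect (f : 'End(E)) :
    'M[k]_(\dim {:E}) :=
  \matrix_(i, j) (B (f e`_i) e`_j + B e`_i (f e`_j)).

Fact skew_defect_linear : linear skew_defect.
Proof.
move=> a f g; apply/matrixP => i j; rewrite !mxE !lfunE /= !lfunE /=.
by rewrite linearPl linearPr /= mulrDr addrACA.
Qed.
HB.instance Definition _ :=
  GRing.isLinear.Build k 'End(E) _ _ skew_defect skew_defect_linear.

(* The infinitesimal isometries of B, i.e. so(E, B) when B is symmetric and   *)
(* sp(E, B) when B is skew-symmetric; see mem_skew_endo.                      *)
Definition skew_endo : {vspace 'End(E)} := lker (linfun skew_defect).

Lemma mem_skew_endo (f : 'End(E)) :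
  f \in skew_endo <-> forall x y, B (f x) y + B x (f y) = 0.
Proof.
rewrite memv_ker lfunE /=; split=> [/eqP/matrixP f0 x y|f0]; last first.
  by apply/eqP/matrixP => i j; rewrite !mxE f0.
rewrite (vbasis_expand x) raddf_sum !linear_sumlz -big_split big1 //= => i _.
rewrite (vbasis_expand y) !raddf_sum -big_split big1 //= => j _.
rewrite !linearZ /= !linearZl_LR /= -!mulrDr.
by have := f0 i j; rewrite !mxE => ->; rewrite !mulr0.
Qed.

Definition isolie : Type := subvs_of skew_endo.
HB.instance Definition _ := Vector.on isolie.

Lemma isolieP (f : isolie) x y : B (vsval f x) y = - B x (vsval f y).
Proof.
apply/eqP; rewrite -addr_eq0; apply/eqP.
by have /mem_skew_endo := subvsP f; apply.
Qed.

Definition commutator (f g : 'End(E)) : 'End(E) := (f \o g)%VF - (g \o f)%VF.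

Lemma commutatorE f g x : commutator f g x = f (g x) - g (f x).
Proof. by rewrite /commutator add_lfunE opp_lfunE !comp_lfunE. Qed.

Fact commutator_skew (f g : isolie) :
  commutator (vsval f) (vsval g) \in skew_endo.
Proof.
apply/mem_skew_endo => x y; rewrite !commutatorE.
by rewrite linearBl linearBr /= !isolieP !opprK subrKA subrr.
Qed.

Definition isolie_lie (f g : isolie) : isolie := Subvs (commutator_skew f g).

Fact isolie_lie_linearl g : linear (isolie_lie ^~ g).
Proof.
move=> a f f'; apply: subvs_inj; rewrite linearP /=; apply/lfunP => x.
rewrite !(commutatorE, add_lfunE, scale_lfunE) linearP /= scalerBr.
by rewrite opprD addrACA.
Qed.

Fact isolie_lie_linearr f : linear (isolie_lie f).
Proof.
move=> a g g'; apply: subvs_inj; rewrite linearP /=; apply/lfunP => x.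
rewrite !(commutatorE, add_lfunE, scale_lfunE) linearP /= scalerBr.
by rewrite opprD addrACA.
Qed.

Fact isolie_lie_alternating f : isolie_lie f f = 0.
Proof. by apply: subvs_inj; apply: subrr. Qed.

Fact isolie_lie_jacobi x y z :
  isolie_lie x (isolie_lie y z) + isolie_lie y (isolie_lie z x)
    + isolie_lie z (isolie_lie x y) = 0.
Proof.
apply: subvs_inj; rewrite !linearD /=; apply/lfunP => v.
rewrite !(commutatorE, add_lfunE) zero_lfunE /= !linearB /=.
rewrite !opprK !addrA.
rewrite [LHS](ACl ((1*11)*(2*8)*(3*5)*(4*10)*(6*12)*(7*9))) /=.
by rewrite !subrr !addNr !addr0.
Qed.

HB.instance Definition _ := Vector_isLie.Build k isolie
  isolie_lie_linearl isolie_lie_linearr isolie_lie_alternating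
  isolie_lie_jacobi.

End Forms.

Notation so := isolie (only parsing).
Notation sp := isolie (only parsing).

Record invariant_form (k : fieldType) (g : lieType k) := InvariantForm {
  invf :> {symmetric g};
  invf_nondegenerate : nondegenerate invf;
  invf_ad : forall x y z, invf (lie x y) z = - invf y (lie x z)
}.

Record quadratic_form (k : fieldType) (E : vectType k) := QuadraticForm {
  qf :> {symmetric E};
  qf_nondegenerate : nondegenerate qf
}.

Record orthogonal_rep (k : fieldType) (g : lieType k) (E : vectType k)
    (q : quadratic_form E) := OrthogonalRep {
  orep :> {linear g -> so q};
  orep_lie : forall x y, orep (lie x y) = lie (orep x) (orep y)
}.

Lemma linfun_linear (k : fieldType) (U V : vectType k) (f : U -> V) :
  linear f -> linfun f =1 f.
Proof.
move=> f_lin; pose fL := GRing.isLinear.Build k U V _ f f_lin.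
by move=> x; rewrite (lfunE (HB.pack f fL : {linear U -> V})).
Qed.

Section Moment.
Variables (k : fieldType) (g : lieType k) (B : invariant_form g).
Variables (E : vectType k) (q : quadratic_form E) (rho : orthogonal_rep g q).

Definition rep_act (x : g) : 'End(E) := vsval (rho x).

Definition flat (x : g) : 'Hom(g, k^o) := linfun (B x : g -> k^o).

Lemma flatE x y : flat x y = B x y.
Proof. by rewrite linfun_linear // => a u v; apply: linearPr. Qed.

Lemma linflatE x : linfun flat x = flat x.
Proof.
apply: linfun_linear => {x} a u v; apply/lfunP => y.
by rewrite !lfunE /= !lfunE /= !flatE linearPl.
Qed.

Fact linflat_ker0 : lker (linfun flat) = 0%VS.
Proof.
apply/eqP/lker0P => x y; rewrite !linflatE => xy.
apply/eqP; rewrite -subr_eq0; apply/eqP.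
apply: (nondegenerateP _ (invf_nondegenerate B)) => z.
by rewrite linearBl /= -!flatE xy subrr.
Qed.

Fact linflat_img : limg (linfun flat) = fullv.
Proof.
apply/eqP; rewrite eqEdim subvf limg_dim_eq ?linflat_ker0 ?capv0 //.
by rewrite !dimvf /dim /= muln1.
Qed.

(* mu(v, w) is the element of g that represents x |-> (rho(x) v, w) through B *)
Definition moment (v w : E) : g :=
  (linfun flat)^-1%VF (linfun (fun x => q (rep_act x v) w : k^o)).

Lemma momentP x v w : B x (moment v w) = q (rep_act x v) w.
Proof.
rewrite (hermC B) expr0 mul1r /= -flatE -linflatE limg_lfunVK.
  rewrite linfun_linear // => a y z.
  by rewrite /rep_act linearP /= !lfunE /= !lfunE linearPl.
by rewrite linflat_img memvf.
Qed.

Lemma moment_unique v w m :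
  (forall x, B x m = q (rep_act x v) w) -> m = moment v w.
Proof.
move=> mP; apply/eqP; rewrite -subr_eq0; apply/eqP.
apply: (nondegenerateP _ (invf_nondegenerate B)) => z.
by rewrite (hermC B) linearBr /= mP momentP subrr mulr0.
Qed.

Lemma moment_alternating v : 2 \notin [pchar k] -> moment v v = 0.
Proof.
move=> char2; apply/esym/moment_unique => x; rewrite linear0r.
have := isolieP (rho x) v v; rewrite (hermC q v) expr0 mul1r /= => /eqP.
rewrite -addr_eq0 -mulr2n -mulr_natl mulf_eq0 => /orP[|/eqP->//].
by rewrite -[2%:R == 0]/(2 \in [pchar k]) (negPf char2).
Qed.

Definition special_orthogonal : Prop := forall u v w : E,
  rep_act (moment u v) w + rep_act (moment u w) v
    = q u v *: w + q u w *: v - (2%:R * q v w) *: u.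

End Moment.

Section Scale.
Variables (k : fieldType) (g : lieType k) (c : k) (B : invariant_form g).

Definition scale_bil (x y : g) : k := c * B x y.

Fact scale_bilP : bilinear_for
  (GRing.Scale.Law.clone _ _ *%R _) (GRing.Scale.Law.clone _ _ *%R _)
  scale_bil.
Proof.
split=> z a x y; rewrite /scale_bil /= ?linearPl ?linearPr /=;
by rewrite mulrDr mulrCA.
Qed.
HB.instance Definition _ :=
  bilinear_isBilinear.Build k g g k *%R (idfun \; *%R) scale_bil scale_bilP.
Fact scale_bil_sym x y :
  scale_bil x y = (-1) ^+ false * idfun (scale_bil y x).
Proof. by rewrite expr0 mul1r /scale_bil (hermC B) expr0 mul1r. Qed.
HB.instance Definition _ :=
  isHermitianSesquilinear.Build k g false idfun scale_bil scale_bil_sym.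

Hypothesis c_neq0 : c != 0.

Fact scale_bil_nondegenerate : nondegenerate scale_bil.
Proof.
apply/nondegenerateP => x Bx.
apply: (nondegenerateP _ (invf_nondegenerate B)) => y.
by apply/eqP; have /eqP := Bx y; rewrite mulf_eq0 (negPf c_neq0).
Qed.

Fact scale_bil_ad x y z : scale_bil (lie x y) z = - scale_bil y (lie x z).
Proof. by rewrite /scale_bil invf_ad mulrN. Qed.

Definition scale_form : invariant_form g :=
  InvariantForm scale_bil_nondegenerate scale_bil_ad.

End Scale.

Section OrthogonalSum.
Variables (k : fieldType) (g h : lieType k).
Variables (B : invariant_form g) (C : invariant_form h).

Definition perp_bil (x y : (g * h)%type) : k := B x.1 y.1 + C x.2 y.2.

Fact perp_bilP : bilinear_for
  (GRing.Scale.Law.clone _ _ *%R _) (GRing.Scale.Law.clone _ _ *%R _)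
  perp_bil.
Proof.
split=> z a x y; rewrite /perp_bil /= ?linearPl ?linearPr /=;
by rewrite mulrDr addrACA.
Qed.
HB.instance Definition _ := bilinear_isBilinear.Build k _ _ k
  *%R (idfun \; *%R) perp_bil perp_bilP.
Fact perp_bil_sym x y : perp_bil x y = (-1) ^+ false * idfun (perp_bil y x).
Proof.
by rewrite expr0 mul1r /perp_bil (hermC B) (hermC C) !expr0 !mul1r.
Qed.
HB.instance Definition _ :=
  isHermitianSesquilinear.Build k _ false idfun perp_bil perp_bil_sym.

Fact perp_bil_nondegenerate : nondegenerate perp_bil.
Proof.
apply/nondegenerateP => -[x y] Bxy; congr pair.
  apply: (nondegenerateP _ (invf_nondegenerate B)) => z.
  have : perp_bil (x, y) (z, 0) = 0 by exact: Bxy.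
  by rewrite /perp_bil /= linear0r addr0.
apply: (nondegenerateP _ (invf_nondegenerate C)) => z.
have : perp_bil (x, y) (0, z) = 0 by exact: Bxy.
by rewrite /perp_bil /= linear0r add0r.
Qed.

Fact perp_bil_ad x y z : perp_bil (lie x y) z = - perp_bil y (lie x z).
Proof. by rewrite /perp_bil !invf_ad opprD. Qed.

Definition perp_form : invariant_form (g * h)%type :=
  InvariantForm perp_bil_nondegenerate perp_bil_ad.

End OrthogonalSum.

Section Trace.
Variables (k : fieldType) (E : vectType k).
Implicit Types f g : 'End(E).

Let e := vbasis {:E}.

Definition lfun_trace f : k := \sum_i coord e i (f e`_i).

Lemma lfun_traceP : scalar lfun_trace.
Proof.
move=> a f g; rewrite mulr_sumr -big_split; apply: eq_bigr => i _ /=.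
by rewrite !lfunE /= !lfunE /= linearP.
Qed.

Lemma lfun_traceC f g : lfun_trace (f \o g)%VF = lfun_trace (g \o f)%VF.
Proof.
have tr_comp (u v : 'End(E)) : lfun_trace (u \o v)%VF =
    \sum_(i < \dim {:E}) \sum_(j < \dim {:E})
      coord e j (v e`_i) * coord e i (u e`_j).
  apply: eq_bigr => i _; rewrite lfunE /= {1}(vbasis_expand (v e`_i)).
  by rewrite !raddf_sum; apply: eq_bigr => j _ /=; rewrite linearZ /= linearZ.
rewrite !tr_comp exchange_big; apply: eq_bigr => i _; apply: eq_bigr => j _.
exact: mulrC.
Qed.

Lemma lfun_trace_rank1 (phi : E -> k) (u : E) f :
  scalar phi -> (forall x, f x = phi x *: u) -> lfun_trace f = phi u.
Proof.
move=> phiP fE.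
have phiE : linfun (phi : E -> k^o) =1 phi by apply: linfun_linear.
rewrite -phiE [in RHS](vbasis_expand u) linear_sum.
by apply: eq_bigr => i _; rewrite fE !linearZ /= phiE mulrC.
Qed.

End Trace.

Section HalfTrace.
Variables (k : fieldType) (V : vectType k) (om : {skew_symmetric V}).

Definition half_trace (f g : sp om) : k :=
  2%:R^-1 * lfun_trace (vsval f \o vsval g)%VF.

Fact half_traceP : bilinear_for
  (GRing.Scale.Law.clone _ _ *%R _) (GRing.Scale.Law.clone _ _ *%R _)
  half_trace.
Proof.
split=> h a f g; rewrite /half_trace linearP /=.
  by rewrite comp_lfunDl -comp_lfunZl lfun_traceP mulrDr mulrCA.
by rewrite comp_lfunDr -comp_lfunZr lfun_traceP mulrDr mulrCA.
Qed.
HB.instance Definition _ := bilinear_isBilinear.Build k _ _ k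
  *%R (idfun \; *%R) half_trace half_traceP.
Fact half_trace_sym f g :
  half_trace f g = (-1) ^+ false * idfun (half_trace g f).
Proof. by rewrite expr0 mul1r /half_trace lfun_traceC. Qed.
HB.instance Definition _ :=
  isHermitianSesquilinear.Build k _ false idfun half_trace half_trace_sym.

Fact half_trace_ad f g h :
  half_trace (lie f g) h = - half_trace g (lie f h).
Proof.
rewrite /half_trace -mulrN; congr (_ * _).
rewrite /lie /= /commutator comp_lfunDl comp_lfunNl comp_lfunDr comp_lfunNr.
pose tr : {linear 'End(V) -> k^o} := HB.pack (@lfun_trace k V)
  (GRing.isLinear.Build k 'End(V) k^o _ _ (@lfun_traceP k V)).
rewrite -![lfun_trace _]/(tr _) !linearB /= opprB; congr (_ - _).
  by rewrite -comp_lfunA lfun_traceC comp_lfunA.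
by rewrite comp_lfunA.
Qed.

Hypotheses (char2 : 2 \notin [pchar k]) (om_symp : is_psymplectic om).

Fact half_trace_nondegenerate : nondegenerate half_trace.
Proof.
have two_neq0 : 2%:R != 0 :> k by apply: contra char2 => ?; apply/andP.
have om_nd := let: And3 h _ _ := om_symp in nondegenerateP _ h.
have omC x y : om x y = - om y x by rewrite hermC expr1 mulN1r.
apply/nondegenerateP => f f0.
have omf v : om v (vsval f v) = 0.
  pose r x := om v x *: v.
  have r_lin : linear r.
    by move=> a x y; rewrite /r linearPr /= scalerDl scalerA.
  have r_sp : linfun r \in skew_endo om.
    apply/mem_skew_endo => x y; rewrite !linfun_linear // /r.
    by rewrite linearZl_LR linearZr_LR /= (omC x v) mulrN mulrC subrr.
  have := f0 (Subvs r_sp); rewrite /= /half_trace /=.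
  rewrite (@lfun_trace_rank1 _ _ (om v) (vsval f v)); first last.
  - by move=> x; rewrite comp_lfunE linfun_linear // linearZ.
  - by move=> a x y; rewrite linearPr.
  by move=> /eqP; rewrite mulf_eq0 invr_eq0 (negPf two_neq0) => /eqP.
apply: subvs_inj; rewrite linear0; apply/lfunP => v; rewrite zero_lfunE.
apply: om_nd => w; apply/eqP.
have := omf (v + w); rewrite linearD linearDl !linearDr /= !omf add0r addr0.
rewrite (omC v) isolieP opprK [om w _]omC isolieP opprK => /eqP.
by rewrite oppr_eq0 -mulr2n -mulr_natl mulf_eq0 (negPf two_neq0).
Qed.

Definition half_trace_form : invariant_form (sp om) :=
  InvariantForm half_trace_nondegenerate half_trace_ad.

End HalfTrace.

Section Tensor.
Variables (k : fieldType) (V W : vectType k).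

Let e := vbasis {:V}.
Let d := vbasis {:W}.

(* The tensor product in coordinates: a matrix t stands for the sum of the    *)
(* t i j *: (e_i (x) d_j), with e, d the vbasis of V, W. Its universal        *)
(* property is tens_liftE (existence) and tens_ext (uniqueness).              *)
Definition tensor : Type := 'M[k]_(\dim {:V}, \dim {:W}).
HB.instance Definition _ := Vector.on tensor.

Definition tens (v : V) (w : W) : tensor :=
  \matrix_(i, j) (coord e i v * coord d j w).

Definition tens_lift (U : lmodType k) (b : V -> W -> U) (t : tensor) : U :=
  \sum_i \sum_j t i j *: b e`_i d`_j.

Lemma tens_lift_def (U : lmodType k) (b : V -> W -> U) t :
  tens_lift b t = \sum_i \sum_j t i j *: b e`_i d`_j.
Proof. by []. Qed.

Lemma tens_bilinear : bilinear_for
  (GRing.Scale.Law.clone _ _ *:%R _) (GRing.Scale.Law.clone _ _ *:%R _) tens.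
Proof.
split=> z a x y; apply/matrixP => i j; rewrite !mxE linearP /=.
  by rewrite mulrDl mulrA.
by rewrite mulrDr mulrCA.
Qed.

Fact tens_lift_linear (U : lmodType k) (b : V -> W -> U) : linear (tens_lift b).
Proof.
move=> a s t; rewrite /tens_lift scaler_sumr -big_split; apply: eq_bigr => i _.
rewrite scaler_sumr -big_split; apply: eq_bigr => j _ /=.
by rewrite !mxE scalerDl scalerA.
Qed.
HB.instance Definition _ (U : lmodType k) (b : V -> W -> U) :=
  GRing.isLinear.Build k tensor U _ (tens_lift b) (tens_lift_linear b).

Lemma tens_lift_comb (U : lmodType k) a (b b1 b2 : V -> W -> U) t :
  (forall v w, b v w = a *: b1 v w + b2 v w) ->
  tens_lift b t = a *: tens_lift b1 t + tens_lift b2 t.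
Proof.
move=> bE; rewrite /tens_lift scaler_sumr -big_split; apply: eq_bigr => i _.
rewrite scaler_sumr -big_split; apply: eq_bigr => j _ /=.
by rewrite bE scalerDr !scalerA mulrC.
Qed.

Lemma tens_liftE (U : lmodType k) (b : V -> W -> U) v w :
  (forall w, linear (b ^~ w)) -> (forall v, linear (b v)) ->
  tens_lift b (tens v w) = b v w.
Proof.
move=> bl br.
have bvE x : b x w = \sum_j coord d j w *: b x d`_j.
  pose bL : {linear W -> U} := HB.pack (b x)
    (GRing.isLinear.Build k W U _ _ (br x)).
  rewrite -[b x]/(bL : W -> U) [in LHS](vbasis_expand w) linear_sum.
  by apply: eq_bigr => j _; rewrite linearZ.
pose bL : {linear V -> U} := HB.pack (b ^~ w)
  (GRing.isLinear.Build k V U _ _ (bl w)).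
rewrite -[b v w]/(bL v) [in RHS](vbasis_expand v) linear_sum.
apply: eq_bigr => i _; rewrite linearZ /= bvE scaler_sumr.
by apply: eq_bigr => j _; rewrite mxE scalerA.
Qed.

Lemma tens_expand (t : tensor) : t = \sum_i \sum_j t i j *: tens e`_i d`_j.
Proof.
have ee := basis_free (vbasisP {:V}); have dd := basis_free (vbasisP {:W}).
apply/matrixP => r s; rewrite summxE (bigD1 r) //= summxE (bigD1 s) //=.
rewrite !mxE !coord_free // !eqxx !mulr1 big1 ?addr0 => [|j js]; last first.
  by rewrite !mxE !coord_free // (negPf js) !mulr0.
rewrite big1 ?addr0 // => i ir; rewrite summxE big1 // => j _.
by rewrite !mxE !coord_free // (negPf ir) mul0r mulr0.
Qed.

Lemma tens_ext (U : lmodType k) (f f' : tensor -> U) :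
  linear f -> linear f' ->
  (forall v w, f (tens v w) = f' (tens v w)) -> f =1 f'.
Proof.
move=> fl fl' ff' t.
pose F : {linear tensor -> U} := HB.pack f (GRing.isLinear.Build k _ U _ _ fl).
pose F' : {linear tensor -> U} :=
  HB.pack f' (GRing.isLinear.Build k _ U _ _ fl').
rewrite -[LHS]/(F t) -[RHS]/(F' t) (tens_expand t) !linear_sum.
apply: eq_bigr => i _; rewrite !linear_sum; apply: eq_bigr => j _.
by rewrite !linearZ /= ff'.
Qed.

End Tensor.

Section TensorRep.
Variables (k : fieldType) (V W : vectType k).
Variables (omV : {skew_symmetric V}) (omW : {skew_symmetric W}).

Definition tens_form (s t : tensor V W) : k :=
  tens_lift (fun v1 w1 =>
    tens_lift (fun v2 w2 => - (omV v1 v2 * omW w1 w2) : k^o) t) s.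

Lemma tens_form_linearl t : scalar (tens_form ^~ t).
Proof. by move=> a s s'; apply: (@tens_lift_linear k V W k^o). Qed.

Lemma tens_form_linearr s : scalar (tens_form s).
Proof.
move=> a t t'; apply: (@tens_lift_comb k V W k^o) => v w.
exact: (@tens_lift_linear k V W k^o).
Qed.

Lemma tens_form_inner v1 w1 v2 w2 :
  tens_lift (fun v w => - (omV v1 v * omW w1 w) : k^o) (tens v2 w2)
    = - (omV v1 v2 * omW w1 w2).
Proof.
rewrite tens_liftE // => z a x y; rewrite linearPr /= ?mulrDl ?mulrDr opprD.
  by rewrite scalerN -mulrA.
by rewrite scalerN mulrCA.
Qed.

Lemma tens_formE v1 w1 v2 w2 :
  tens_form (tens v1 w1) (tens v2 w2) = - (omV v1 v2 * omW w1 w2).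
Proof.
rewrite /tens_form tens_liftE /= ?tens_form_inner // => z a x y.
  by rewrite !tens_form_inner linearPl /= mulrDl opprD scalerN -mulrA.
by rewrite !tens_form_inner linearPl /= mulrDr opprD scalerN mulrCA.
Qed.

Fact tens_formP : bilinear_for
  (GRing.Scale.Law.clone _ _ *%R _) (GRing.Scale.Law.clone _ _ *%R _)
  tens_form.
Proof. by split=> z; [apply: tens_form_linearl | apply: tens_form_linearr]. Qed.
HB.instance Definition _ := bilinear_isBilinear.Build k _ _ k
  *%R (idfun \; *%R) tens_form tens_formP.
Fact tens_form_sym s t :
  tens_form s t = (-1) ^+ false * idfun (tens_form t s).
Proof.
rewrite expr0 mul1r /=; move: s.
apply: (@tens_ext k V W k^o (tens_form ^~ t) (tens_form t)) => [||v w].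
- exact: tens_form_linearl.
- exact: tens_form_linearr.
move: t; apply: (@tens_ext k V W k^o (tens_form _) (tens_form ^~ _)) => [||x y].
- exact: tens_form_linearr.
- exact: tens_form_linearl.
rewrite !tens_formE (hermC omV) (hermC omW) /= expr1 !mulN1r.
by rewrite mulrNN.
Qed.
HB.instance Definition _ :=
  isHermitianSesquilinear.Build k _ false idfun tens_form tens_form_sym.

Lemma psymplecticP (E : vectType k) (om : {skew_symmetric E}) :
  is_psymplectic om -> forall x, (forall y, om x y = 0) -> x = 0.
Proof. by case=> /nondegenerateP. Qed.

Fact tens_form_nondegenerate :
  is_psymplectic omV -> is_psymplectic omW -> nondegenerate tens_form.
Proof.
move=> ndV ndW; apply/nondegenerateP => t t0.
have /freeP eV := basis_free (vbasisP {:V}).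
have /freeP dW := basis_free (vbasisP {:W}).
have tV j v : omV (\sum_i t i j *: (vbasis {:V})`_i) v = 0.
  rewrite linear_sumlz.
  apply: (dW (fun j => \sum_i omV (t i j *: (vbasis {:V})`_i) v)).
  apply: (psymplecticP ndW) => w; apply/eqP; rewrite -oppr_eq0; apply/eqP.
  rewrite -[RHS](t0 (tens v w)) /= linear_sumlz /tens_form.
  rewrite (tens_lift_def _ t) exchange_big.
  rewrite -sumrN; apply: eq_bigr => j' _; rewrite linearZl_LR mulr_suml -sumrN.
  apply: eq_bigr => i _ /=; rewrite tens_form_inner.
  by rewrite linearZl_LR /= scalerN -mulrA.
apply/matrixP => i j; rewrite mxE; apply: (eV (fun i => t i j)).
by apply: (psymplecticP ndV); apply: tV.
Qed.

Definition tens_quadratic_form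
    (sV : is_psymplectic omV) (sW : is_psymplectic omW) :
  quadratic_form (tensor V W) :=
  QuadraticForm (tens_form_nondegenerate sV sW).

Definition tens_act (f : 'End(V)) (g : 'End(W)) : 'End(tensor V W) :=
  linfun (tens_lift (fun v w => tens (f v) w + tens v (g w))).

Lemma tensPl (w : W) : linear (fun v : V => tens v w).
Proof. by move=> a x y; apply: (@tens_bilinear k V W).1. Qed.

Lemma tensPr (v : V) : linear (fun w : W => tens v w).
Proof. by move=> a x y; apply: (@tens_bilinear k V W).2. Qed.

Lemma tensBl (w : W) v v' :
  tens (v - v') w = tens v w - tens v' w :> tensor V W.
Proof. exact: (zmod_morphism_linear (tensPl w)). Qed.

Lemma tensBr (v : V) w w' :
  tens v (w - w') = tens v w - tens v w' :> tensor V W.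
Proof. exact: (zmod_morphism_linear (tensPr v)). Qed.

Lemma tens_actE f g v w :
  tens_act f g (tens v w) = tens (f v) w + tens v (g w).
Proof.
rewrite lfunE /= tens_liftE // => z a x y; rewrite linearP.
  by rewrite !tensPl scalerDr addrACA.
by rewrite !tensPr scalerDr addrACA.
Qed.

Lemma tens_lfunP (f f' : 'End(tensor V W)) :
  (forall v w, f (tens v w) = f' (tens v w)) -> f = f'.
Proof. by move=> ff'; apply/lfunP; apply: tens_ext => //; apply: linearP. Qed.

Fact tens_act_skew (x : (sp omV * sp omW)%type) :
  tens_act (vsval x.1) (vsval x.2) \in skew_endo tens_form.
Proof.
apply/mem_skew_endo; set A := tens_act _ _ => s t; apply/eqP.
rewrite addr_eq0; apply/eqP; move: s.
apply: (@tens_ext k V W k^o (fun s => tens_form (A s) t)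
   (fun s => - tens_form s (A t))) => [a y z|a y z|v1 w1].
- by rewrite linearP tens_form_linearl.
- by rewrite tens_form_linearl opprD scalerN.
move: t; apply: (@tens_ext k V W k^o (fun t => tens_form (A _) t)
   (fun t => - tens_form _ (A t))) => [a y z|a y z|v2 w2].
- by rewrite tens_form_linearr.
- by rewrite linearP tens_form_linearr opprD scalerN.
rewrite !tens_actE linearDl linearDr /= !tens_formE !isolieP.
by rewrite mulNr mulrN !opprD !opprK.
Qed.

Definition tens_rho (x : (sp omV * sp omW)%type) : so tens_form :=
  Subvs (tens_act_skew x).

Fact tens_rho_linear : linear tens_rho.
Proof.
move=> a x y; apply: subvs_inj; rewrite linearP /=; apply: tens_lfunP => v w.
rewrite add_lfunE scale_lfunE !tens_actE.
rewrite !add_lfunE !scale_lfunE.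
by rewrite tensPl tensPr scalerDr addrACA.
Qed.
HB.instance Definition _ :=
  GRing.isLinear.Build k _ _ _ tens_rho tens_rho_linear.

Fact tens_rho_lie x y : tens_rho (lie x y) = lie (tens_rho x) (tens_rho y).
Proof.
apply: subvs_inj; apply: tens_lfunP => v w.
rewrite /= commutatorE !tens_actE !linearD /= !tens_actE !commutatorE.
rewrite tensBl tensBr !opprD !addrA.
rewrite [RHS](ACl (((1*5)*4*8)*(2*7)*(3*6))) /=.
by rewrite !subrr !addr0.
Qed.

Definition tens_rep (sV : is_psymplectic omV) (sW : is_psymplectic omW) :
  orthogonal_rep (sp omV * sp omW)%type (tens_quadratic_form sV sW) :=
  @OrthogonalRep _ _ _ (tens_quadratic_form sV sW) tens_rho tens_rho_lie.

End TensorRep.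

(* Main.v *)
Require Import Defs.
From mathcomp Require Import all_boot all_order all_algebra.
From mathcomp Require Import ring.

(** For a symplectic space [(V, om)], the quadratic map [S^2 V -> sp(V, om)]
    sends [v w] to [x |-> om(v, x) w + om(w, x) v] ([sym_rank2]), and
    [K(f, v w) = - om(f v, w)] ([half_trace_sym_rank2]): up to sign this is the
    moment map of [V].  Since the form on [V (x) W] is [- omV omW], the moment
    map of the tensor product representation for [1/alpha K_V _|_ 1/beta K_W] is
    [mu(v1 w1, v2 w2) = (alpha omW(w1, w2) v1 v2, beta omV(v1, v2) w1 w2]), see
    [tens_moment].

    In a plane any three vectors satisfy the cyclic relation
    [om(x, y) z + om(y, z) x + om(z, x) y = 0] ([plane_cyclic]).  Used in both
    [V] and [W], it collapses the left side of the special orthogonality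
    equation on pure tensors to [- (alpha + beta)] times its right side.  Hence
    the difference of the two sides is [alpha + beta + 1] times an expression
    [T] independent of [alpha] and [beta] ([tens_special_defectE]).  The
    difference is trilinear, so it vanishes everywhere once it vanishes on pure
    tensors, and [alpha + beta = -1] suffices.  Conversely [T] is not
    identically zero: at [u = v = x (x) y], [w = x' (x) y'] it is a nonzero
    multiple of [x (x) y] as soon as [omV(x, x')] and [omW(y, y')] are nonzero. *)

Set Implicit Arguments.
Unset Strict Implicit.
Unset Printing Implicit Defensive.

Import GRing.Theory.
Local Open Scope ring_scope.

(** * Linear preliminaries *)

Lemma linear_const0 (k : fieldType) (E F : lmodType k) :
  linear (fun _ : E => 0 : F).
Proof. by move=> a x y; rewrite scaler0 addr0. Qed.

(** Turns an identity between vectors into scalar identities, where [ring]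
    applies. *)
Lemma coord_vbasis_inj (k : fieldType) (E : vectType k) (x y : E) :
  (forall i, coord (vbasis {:E}) i x = coord (vbasis {:E}) i y) -> x = y.
Proof.
move=> xy; rewrite (vbasis_expand x) (vbasis_expand y).
by apply: eq_bigr => i _; rewrite xy.
Qed.

(** * Trilinearity of the special orthogonality equation *)

Section SpecialDefect.
Variables (k : fieldType) (g : lieType k) (B : invariant_form g).
Variables (E : vectType k) (q : quadratic_form E) (rho : orthogonal_rep g q).

Lemma moment_linearl w : linear (fun v => moment B rho v w).
Proof.
move=> a v v'; apply/esym/moment_unique => x.
by rewrite linearPr /= !momentP linearP linearPl.
Qed.

Lemma moment_linearr v : linear (moment B rho v).
Proof.
move=> a w w'; apply/esym/moment_unique => x.
by rewrite linearPr /= !momentP linearPr.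
Qed.

Lemma rep_act_linear v : linear (fun x => rep_act rho x v).
Proof.
by move=> a x y; rewrite /rep_act linearP /= add_lfunE scale_lfunE.
Qed.

Definition special_defect (u v w : E) : E :=
  rep_act rho (moment B rho u v) w + rep_act rho (moment B rho u w) v
    - (q u v *: w + q u w *: v - (2%:R * q v w) *: u).

Lemma special_defectP :
  special_orthogonal B rho <-> forall u v w, special_defect u v w = 0.
Proof.
by split=> H u v w; apply/eqP; have /eqP := H u v w; rewrite subr_eq0.
Qed.

Lemma special_defect_linear1 v w : linear (fun u => special_defect u v w).
Proof.
move=> a u u'; rewrite /special_defect !moment_linearl !rep_act_linear.
rewrite !linearPl /=; apply: coord_vbasis_inj => i.
by rewrite !(linearD, linearB, linearN, linearZ) /=; ring.
Qed.

Lemma special_defect_linear2 u w : linear (fun v => special_defect u v w).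
Proof.
move=> a v v'; rewrite /special_defect !moment_linearr !rep_act_linear.
rewrite !linearPl !linearPr linearP /=; apply: coord_vbasis_inj => i.
by rewrite !(linearD, linearB, linearN, linearZ) /=; ring.
Qed.

Lemma special_defect_linear3 u v : linear (special_defect u v).
Proof.
move=> a w w'; rewrite /special_defect !moment_linearr !rep_act_linear.
rewrite !linearPr linearP /=; apply: coord_vbasis_inj => i.
by rewrite !(linearD, linearB, linearN, linearZ) /=; ring.
Qed.

End SpecialDefect.

(** * The quadratic map from a symplectic space to its Lie algebra *)

Section SymRank2.
Variables (k : fieldType) (V : vectType k) (om : {skew_symmetric V}).

Lemma skew_sym_opp x y : om x y = - om y x.
Proof. by rewrite hermC expr1 mulN1r. Qed.

Definition sym_rank2_fun (v w x : V) : V := om v x *: w + om w x *: v.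

Lemma sym_rank2_fun_linear v w : linear (sym_rank2_fun v w).
Proof.
move=> a x y; rewrite /sym_rank2_fun !linearPr /=.
by apply: coord_vbasis_inj => i; rewrite !(linearD, linearZ) /=; ring.
Qed.

Fact sym_rank2_skew v w : linfun (sym_rank2_fun v w) \in skew_endo om.
Proof.
apply/mem_skew_endo => x y; rewrite !linfun_linear;
  try exact: sym_rank2_fun_linear.
rewrite /sym_rank2_fun linearDl linearDr /= !linearZl_LR !linearZr_LR /=.
by rewrite (skew_sym_opp x v) (skew_sym_opp x w); ring.
Qed.

Definition sym_rank2 (v w : V) : sp om := Subvs (sym_rank2_skew v w).

Lemma sym_rank2E v w x : vsval (sym_rank2 v w) x = om v x *: w + om w x *: v.
Proof. by rewrite /= linfun_linear //; apply: sym_rank2_fun_linear. Qed.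

(** After composition with [f], each of the two rank one summands of
    [sym_rank2 v w] has trace [- om (f v) w]; the factor one half in the trace
    form averages them. *)
Lemma half_trace_sym_rank2 (char2 : 2%N \notin [pchar k]) f v w :
  half_trace f (sym_rank2 v w) = - om (vsval f v) w.
Proof.
have two_neq0 : 2%:R != 0 :> k by apply: contra char2 => ?; apply/andP.
have R_lin a b : linear (fun x => om a x *: vsval f b).
  by move=> c x y; rewrite linearPr /= scalerDl scalerA.
have trR a b :
    lfun_trace (linfun (fun x => om a x *: vsval f b)) = - om (vsval f a) b.
  rewrite (@lfun_trace_rank1 _ _ (om a) (vsval f b)).
  - by rewrite isolieP opprK.
  - by move=> c x y; rewrite linearPr.
  - by move=> x; rewrite linfun_linear.
(* lfun_traceP handles a *: f + g, whence the coefficient 1. *)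
have -> : half_trace f (sym_rank2 v w) = 2%:R^-1 *
    lfun_trace (1 *: linfun (fun x => om v x *: vsval f w)
                 + linfun (fun x => om w x *: vsval f v)).
  congr (_ * lfun_trace _); apply/lfunP => x.
  rewrite comp_lfunE sym_rank2E add_lfunE scale_lfunE !linfun_linear //.
  by rewrite scale1r linearD !linearZ.
rewrite lfun_traceP !trR mul1r isolieP opprK (skew_sym_opp v) -opprD.
by field.
Qed.

End SymRank2.

(** * Symplectic planes *)

Section SymplecticPlane.
Variables (k : fieldType) (char2 : 2%N \notin [pchar k]) (V : vectType k).
Variables (om : {skew_symmetric V}) (dimV : \dim {:V} = 2%N).

Lemma skew_sym_self x : om x x = 0.
Proof.
have two_neq0 : 2%:R != 0 :> k by apply: contra char2 => ?; apply/andP.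
have /eqP := skew_sym_opp om x x.
by rewrite -addr_eq0 -mulr2n -mulr_natl mulf_eq0 (negPf two_neq0) => /eqP.
Qed.

Lemma plane_span :
  {e : V * V | forall x, exists a b, x = a *: e.1 + b *: e.2}.
Proof.
have := span_basis (vbasisP {:V}); have := size_tuple (vbasis {:V}).
rewrite {2}dimV; case: (tval _) => [|e0 [|e1 []]] //= _ spanV.
exists (e0, e1) => x; have : x \in <<[:: e0; e1]>>%VS by rewrite spanV memvf.
rewrite span_cons span_seq1 => /memv_addP[_ /vlineP[a ->] [_ /vlineP[b ->] ->]].
by exists a, b.
Qed.

(** The cyclic sum of [om x y *: z] alternates in three vectors of a plane,
    hence vanishes; solved for [om x y *: z], it is a Cramer rule. *)
Lemma plane_cyclic x y z : om x y *: z = om x z *: y - om y z *: x.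
Proof.
have [[e0 e1] /= eP] := plane_span.
have [a [b ->]] := eP x; have [c [d ->]] := eP y; have [s [t ->]] := eP z.
rewrite !(linearDl, linearDr) /= !(linearZl_LR, linearZr_LR) /=.
rewrite !skew_sym_self (skew_sym_opp om e1 e0).
by apply: coord_vbasis_inj => i; rewrite !(linearD, linearN, linearZ) /=; ring.
Qed.

Lemma symplectic_plane_pair :
  is_psymplectic om -> exists x y, om x y != 0.
Proof.
move=> symp; have [[e0 e1] /= eP] := plane_span.
exists e0, e1; apply/eqP => om0.
have om_eq0 x y : om x y = 0.
  have [a [b ->]] := eP x; have [c [d ->]] := eP y.
  rewrite !(linearDl, linearDr) /= !(linearZl_LR, linearZr_LR) /=.
  by rewrite !skew_sym_self (skew_sym_opp om e1 e0) om0; ring.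
have V0 : fullv = 0%VS :> {vspace V}.
  apply/vspaceP => x; rewrite memvf memv0; apply/esym/eqP.
  by apply: (psymplecticP symp).
by move: dimV; rewrite V0 dimv0.
Qed.

End SymplecticPlane.

(** * The moment map of the tensor product *)

Section TensorMoment.
Variables (k : fieldType) (char2 : 2%N \notin [pchar k]) (V W : vectType k).
Variables (omV : {skew_symmetric V}) (omW : {skew_symmetric W}).
Variables (sympV : is_psymplectic omV) (sympW : is_psymplectic omW).
Variables (alpha beta : k) (alpha0 : alpha != 0) (beta0 : beta != 0).

Let B := perp_form
  (scale_form (half_trace_form char2 sympV) (invr_neq0 alpha0))
  (scale_form (half_trace_form char2 sympW) (invr_neq0 beta0)).
Let rho := tens_rep sympV sympW.

(** The scalars [alpha] and [beta] undo the rescaling of the trace forms, and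
    the sign in [half_trace_sym_rank2] matches the one in [omV (x) omW]. *)
Lemma tens_moment v1 w1 v2 w2 :
  moment B rho (tens v1 w1) (tens v2 w2) =
    ((alpha * omW w1 w2) *: sym_rank2 omV v1 v2,
     (beta * omV v1 v2) *: sym_rank2 omW w1 w2).
Proof.
apply/esym/moment_unique => -[f g].
rewrite -[LHS]/(alpha^-1 * half_trace f _ + beta^-1 * half_trace g _) /=.
rewrite !linearZr_LR /= !half_trace_sym_rank2 //.
rewrite -[RHS]/(tens_form omV omW (tens_act (vsval f) (vsval g) _) _).
rewrite tens_actE linearDl /= !tens_formE /=; field.
by rewrite alpha0 beta0.
Qed.

(** The two sides of the special orthogonality equation are proportional on
    pure tensors: for each of [alpha] and [beta], one cyclic relation rewrites
    the diagonal terms and the other one recombines the remaining cross terms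
    into a multiple of [tens v1 w1]. *)
Lemma tens_special_defectE (dimV : \dim {:V} = 2%N) (dimW : \dim {:W} = 2%N)
    v1 w1 v2 w2 v3 w3 :
  special_defect B rho (tens v1 w1) (tens v2 w2) (tens v3 w3) =
    (alpha + beta + 1) *:
      ((omV v1 v2 * omW w1 w2) *: tens v3 w3
       + (omV v1 v3 * omW w1 w3) *: tens v2 w2
       - (2%:R * (omV v2 v3 * omW w2 w3)) *: tens v1 w1).
Proof.
rewrite /special_defect !tens_moment.
have actE f g v w : rep_act rho (f, g) (tens v w)
    = tens (vsval f v) w + tens v (vsval g w) by apply: tens_actE.
have qE v w v' w' : tens_quadratic_form sympV sympW (tens v w) (tens v' w')
    = - (omV v v' * omW w w') by apply: tens_formE.
rewrite !actE !linearZ /= !scale_lfunE !sym_rank2E !qE.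
apply/matrixP => i j; rewrite !mxE !(linearD, linearZ) /=.
rewrite (skew_sym_opp omV v3 v2) (skew_sym_opp omW w3 w2).
have := congr1 (coord (vbasis {:V}) i) (plane_cyclic char2 omV dimV v1 v2 v3).
have := congr1 (coord (vbasis {:W}) j) (plane_cyclic char2 omW dimW w1 w2 w3).
rewrite !(linearB, linearZ) /= => cycW cycV.
by ring: cycV cycW.
Qed.

End TensorMoment.

Theorem proposition3p1 (k : fieldType)
    (char2 : 2%N \notin [pchar k]) (char3 : 3%N \notin [pchar k])
    (V W : vectType k)
    (omV : {skew_symmetric V}) (omW : {skew_symmetric W})
    (sympV : is_psymplectic omV) (sympW : is_psymplectic omW)
    (dimV : \dim {:V} = 2%N) (dimW : \dim {:W} = 2%N)
    (alpha beta : k) (alpha0 : alpha != 0) (beta0 : beta != 0) :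
  special_orthogonal
    (perp_form
       (scale_form (half_trace_form char2 sympV) (invr_neq0 alpha0))
       (scale_form (half_trace_form char2 sympW) (invr_neq0 beta0)))
    (tens_rep sympV sympW)
  <-> alpha + beta = -1.
Proof.
have defectE := tens_special_defectE char2 sympV sympW alpha0 beta0 dimV dimW.
split=> [/special_defectP special | sum_ab]; last first.
  apply/special_defectP => u v w.
  move: u; apply: tens_ext => [||v1 w1].
  - exact: special_defect_linear1.
  - exact: linear_const0.
  move: v; apply: tens_ext => [||v2 w2].
  - exact: special_defect_linear2.
  - exact: linear_const0.
  move: w; apply: tens_ext => [||v3 w3].
  - exact: special_defect_linear3.
  - exact: linear_const0.
  by rewrite defectE sum_ab addNr scale0r.
have [x [x' omVx]] := symplectic_plane_pair char2 dimV sympV.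
have [y [y' omWy]] := symplectic_plane_pair char2 dimW sympW.
have := defectE x y x y x' y'.
rewrite special !skew_sym_self // !mul0r scale0r add0r -scalerBl scalerA.
(* Pairing with tens x' y' detects that tens x y is nonzero. *)
move=> /esym/(congr1 (fun t => tens_form omV omW t (tens x' y'))).
have -> (c : k) : c - 2%:R * c = - c by ring.
rewrite linearZl_LR linear0l /= tens_formE => /eqP.
rewrite !(mulf_eq0, oppr_eq0) (negPf omVx) (negPf omWy) !orbF addr_eq0.
by move/eqP.
Qed.
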